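(* Let $T$ be a finite rooted tree with node set $\mathcal V$ and cost function $c:\mathcal V\to\mathbb R_{\ge0}$, and let $B\ge1$ be an integer budget. Suppose that for every hypernode $\mathbf u$ with $S(\mathbf u)\neq\emptyset$ we have $\sum_{\mathbf x\in H(\mathbf u)}\mathrm{Cost}(T_{\mathbf x})>0$, and the SEP algorithm uses the distribution \[P_{\mathbf u}(\mathbf w)=\frac{\mathrm{Cost}(T_{\mathbf w})}{\sum_{\mathbf x\in H(\mathbf u)}\mathrm{Cost}(T_{\mathbf x})},\qquad \mathbf w\in H(\mathbf u).\] Then for every nonempty hypernode $\mathbf v$, the output of the SEP algorithm started at $\mathbf v$ satisfies, with probability one, \[C_{\mathrm{SEP}}(T_{\mathbf v})=\frac{\mathrm{Cost}(T_{\mathbf v})}{|\mathbf v|},\] i.e. it is a zero-variance estimator.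
   Context: For a node $v$, $S(v)$ is its set of children and $T_v$ is the subtree rooted at $v$, with $\mathrm{Cost}(T_v)=\sum_{u\in T_v}c(u)$. A hypernode is a set of distinct nodes of $T$ all at the same depth. For a set of nodes $\mathbf v$: $c(\mathbf v)=\sum_{v\in\mathbf v}c(v)$, $S(\mathbf v)=\bigcup_{v\in\mathbf v}S(v)$, $T_{\mathbf v}=\bigcup_{v\in\mathbf v}T_v$, and $\mathrm{Cost}(T_{\mathbf v})=\sum_{v\in\mathbf v}\mathrm{Cost}(T_v)$. The hyperchildren of $\mathbf v$ are $H(\mathbf v)=\{\mathbf w\subseteq S(\mathbf v): |\mathbf w|=\min(B,|S(\mathbf v)|)\}$. SEP algorithm started at $\mathbf v$ (given distributions $P_{\mathbf u}$ on $H(\mathbf u)$): set $k=0$, $\mathbf x_0=\mathbf v$, $D=1$, $C=c(\mathbf x_0)/|\mathbf x_0|$. Repeat: if $S(\mathbf x_k)=\emptyset$, stop and output $C_{\mathrm{SEP}}(T_{\mathbf v})=C$. Otherwise choose $\mathbf x_{k+1}\in H(\mathbf x_k)$ at random with probability $P(\mathbf x_{k+1}):=P_{\mathbf x_k}(\mathbf x_{k+1})$, set $D_k=\frac{|\mathbf x_{k+1}|}{|\mathbf x_k|}\binom{|S(\mathbf x_k)|-1}{|\mathbf x_{k+1}|-1}^{-1}P(\mathbf x_{k+1})^{-1}$, $D\leftarrow D\cdot D_k$, $C\leftarrow C+\frac{c(\mathbf x_{k+1})}{|\mathbf x_{k+1}|}D$, and $k\leftarrow k+1$. *)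

(* Defs.v *)
From HB Require Import structures.
From mathcomp Require Import all_boot all_order all_algebra.

Set Implicit Arguments.
Unset Strict Implicit.
Unset Printing Implicit Defensive.

Import Order.TTheory GRing.Theory Num.Theory.
Local Open Scope ring_scope.

(** A finite rooted tree is given by its parent map; the root, which has no
    parent, is sent to itself by convention, and iterating [parent] from any
    node leads to the root. *)
Record rooted_tree (V : finType) := RootedTree {
  root : V;
  parent : V -> V;
  parent_root : parent root = root;
  parent_to_root : forall v, fconnect parent v root
}.

Section Tree.
Variables (V : finType) (T : rooted_tree V).

Definition depth (v : V) : nat := findex (parent T) v (root T).

(** The test [w != root T] removes the loop at the root. *)
Definition children (v : V) : {set V} :=
  [set w | (w != root T) && (parent T w == v)].

(** The nodes having [v] among their ancestors, [v] included. *)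
Definition subtree (v : V) : {set V} := [set u | fconnect (parent T) u v].

Definition hypernode (vs : {set V}) : Prop :=
  {in vs &, forall u v, depth u = depth v}.

Definition hchildren (vs : {set V}) : {set V} := \bigcup_(v in vs) children v.

Definition hyperchildren (B : nat) (vs : {set V}) : {set {set V}} :=
  [set ws : {set V} | (ws \subset hchildren vs)
                      && (#|ws| == minn B #|hchildren vs|)].

End Tree.

Section Costs.
Variables (R : realFieldType) (V : finType) (T : rooted_tree V) (c : V -> R).

Definition hcost (vs : {set V}) : R := \sum_(v in vs) c v.

Definition Cost (v : V) : R := \sum_(u in subtree T v) c u.

Definition hCost (vs : {set V}) : R := \sum_(v in vs) Cost v.

End Costs.

(** Finitely supported laws, as lists of (weight, outcome) pairs; an outcome may
    be listed several times, and its weights then add up. *)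
Section FiniteLaws.
Variable R : realFieldType.

Definition law (A : Type) := seq (R * A).

Definition law_ret (A : Type) (a : A) : law A := [:: (1, a)].

Definition law_bind (A A' : Type) (d : law A) (f : A -> law A') : law A' :=
  flatten [seq [seq (p.1 * q.1, q.2) | q <- f p.2] | p <- d].

Definition law_on (A : finType) (E : {set A}) (f : A -> R) : law A :=
  [seq (f a, a) | a <- enum E].

Definition Pr (A : Type) (d : law A) (E : pred A) : R :=
  \sum_(p <- d | E p.2) p.1.

Definition Exp (d : law R) : R := \sum_(p <- d) p.1 * p.2.

Definition Var (d : law R) : R := \sum_(p <- d) p.1 * (p.2 - Exp d) ^+ 2.

End FiniteLaws.

Section SEP.
Variables (R : realFieldType) (V : finType) (T : rooted_tree V) (c : V -> R).
Variables (B : nat) (P : {set V} -> {set V} -> R).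

(** The factor D_k for the step from [x] to its hyperchild [y]. *)
Definition SEP_factor (x y : {set V}) : R :=
  #|y|%:R / #|x|%:R * ('C(#|hchildren T x|.-1, #|y|.-1))%:R^-1 * (P x y)^-1.

(** The law of the output when the loop is entered with current hypernode [x]
    and current values [D], [C]. The counter [n] bounds the number of random
    choices; a run that exceeds it yields no outcome, so its weight is lost. *)
Fixpoint SEP_loop (n : nat) (x : {set V}) (D C : R) : law R R :=
  if hchildren T x == set0 then law_ret R C else
  if n is n'.+1 then
    law_bind (law_on (hyperchildren T B x) (P x)) (fun y =>
      let D' := D * SEP_factor x y in
      SEP_loop n' y D' (C + hcost c y / #|y|%:R * D'))
  else [::].

(** The depth increases at each step, so that no run of the algorithm started
    at a hypernode makes more than [#|V|] choices. *)
Definition SEP (vs : {set V}) : law R R :=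
  SEP_loop #|V| vs 1 (hcost c vs / #|vs|%:R).

End SEP.

(* Main.v *)
(** Expand Cost(T_u) = c(u) + (sum of Cost(T_w) over the children w of u).
    Every child of a hypernode x lies in binom(|S(x)|-1, |y|-1) hyperchildren y,
    so the normalising constant of P_x is that binomial times
    Cost(T_x) - c(x).  The factor D_k therefore simplifies to
    (|y| / |x|) (Cost(T_x) - c(x)) / Cost(T_y), and
    C + D (Cost(T_x) - c(x)) / |x| is unchanged by every step of positive
    probability.  It is Cost(T_v) / |v| at the start and C at the end. *)
Require Import Defs.
From HB Require Import structures.
From mathcomp Require Import all_boot all_order all_algebra.
From mathcomp Require Import ring.

Set Implicit Arguments.
Unset Strict Implicit.
Unset Printing Implicit Defensive.

Import Order.TTheory GRing.Theory Num.Theory.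
Local Open Scope ring_scope.

(** * Depth, ancestors and hyperchildren in the tree *)

Section TreeTheory.
Variables (V : finType) (T : rooted_tree V).

Lemma parent_iter_depth (v : V) : iter (depth T v) (parent T) v = Defs.root T.
Proof. exact: iter_findex (parent_to_root T v). Qed.

Lemma depth_root : depth T (Defs.root T) = 0%N.
Proof. exact: findex0. Qed.

Lemma depth_eq0 (v : V) : (depth T v == 0%N) = (v == Defs.root T).
Proof. by rewrite /depth findex_eq0. Qed.

Lemma depth_parent (v : V) : depth T (parent T v) = (depth T v).-1.
Proof.
case: (eqVneq (Defs.root T) v) => [<-|vr].
  by rewrite parent_root depth_root.
by rewrite /depth [in RHS](fconnect_findex (parent_to_root T v) vr).
Qed.

Lemma depth_iter_parent (k : nat) (v : V) :
  depth T (iter k (parent T) v) = (depth T v - k)%N.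
Proof.
by elim: k => [|k IHk]; rewrite ?subn0 // iterS depth_parent IHk subnS.
Qed.

Lemma depth_lt_card (v : V) : (depth T v < #|V|)%N.
Proof.
apply: leq_trans (findex_max (parent_to_root T v)) _.
exact: max_card.
Qed.

Lemma depth_child (v w : V) : w \in children T v -> depth T w = (depth T v).+1.
Proof.
rewrite inE => /andP[wr /eqP <-]; rewrite depth_parent prednK //.
by rewrite lt0n depth_eq0.
Qed.

(** Each application of [parent] lowers the depth by one until the root is reached, so an ancestor
    of [u] is determined by its depth. *)
Lemma fconnect_parentE (u v : V) :
  fconnect (parent T) u v =
  (iter (depth T u - depth T v) (parent T) u == v).
Proof.
apply/idP/eqP => [uv|<-]; last exact: fconnect_iter.
have ev := iter_findex uv; set k := findex _ u v in ev.
have dv : depth T v = (depth T u - k)%N by rewrite -ev depth_iter_parent.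
(* If [k] exceeds the depth of [u], the truncated difference in [dv] is 0 and [v] is the root. *)
have [kd|dk] := leqP k (depth T u); first by rewrite dv subKn.
have vr : v = Defs.root T.
  by apply/eqP; rewrite -depth_eq0 dv subn_eq0 ltnW.
by rewrite vr depth_root subn0 parent_iter_depth.
Qed.

Lemma fconnect_depth (u v : V) :
  fconnect (parent T) u v -> (depth T v <= depth T u)%N.
Proof. by rewrite fconnect_parentE => /eqP <-; rewrite depth_iter_parent leq_subr. Qed.

Lemma mem_hchildren (x : {set V}) (w : V) :
  (w \in hchildren T x) = (w != Defs.root T) && (parent T w \in x).
Proof.
apply/bigcupP/andP => [[v vx]|[wr px]].
  by rewrite inE => /andP[-> /eqP->].
by exists (parent T w); rewrite ?inE ?wr ?eqxx.
Qed.

Lemma depth_hchild (x : {set V}) (w : V) :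
  w \in hchildren T x -> exists2 v, v \in x & depth T w = (depth T v).+1.
Proof. by case/bigcupP=> v vx /depth_child; exists v. Qed.

Lemma hypernode_hchild (B : nat) (x y : {set V}) :
  hypernode T x -> y \in hyperchildren T B x -> hypernode T y.
Proof.
move=> hx; rewrite inE => /andP[/subsetP yS _] u w /yS /depth_hchild[u' u'x ->].
by move=> /yS /depth_hchild[w' w'x ->]; rewrite (hx u' w').
Qed.

(** Adding [w] is a bijection from the subsets of [S :\ w] of size [m.-1] onto the hyperchildren
    that contain [w]. *)
Lemma card_hyperchildren_mem (B : nat) (x : {set V}) (w : V) :
  (0 < B)%N -> w \in hchildren T x ->
  #|[set y in hyperchildren T B x | w \in y]| =
  'C(#|hchildren T x|.-1, (minn B #|hchildren T x|).-1).
Proof.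
set S := hchildren T x; move=> B0 wS; set m := minn _ _.
have m0 : (0 < m)%N by rewrite leq_min B0 card_gt0; apply/set0Pn; exists w.
have -> : #|S|.-1 = #|S :\ w| by rewrite (cardsD1 w S) wS.
rewrite -cards_draws.
have injw : {in [set A : {set V} | A \subset S :\ w & #|A| == m.-1] &,
    injective (fun A : {set V} => w |: A)}.
  move=> A A'; rewrite !inE !subsetD1 => /andP[/andP[_ wA] _].
  move=> /andP[/andP[_ wA'] _] eAA'.
  by rewrite -(setU1K wA) eAA' setU1K.
rewrite -(card_in_imset injw); apply: eq_card => y.
rewrite !inE -/S -/m; apply/andP/imsetP => [[/andP[yS ym] wy]|[A]].
  exists (y :\ w); last by rewrite setD1K.
  by rewrite inE setSD //= -(eqP ym) (cardsD1 w y) wy.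
rewrite inE subsetD1 => /andP[/andP[AS wA] Am] ->.
by rewrite subUset sub1set wS AS cardsU1 wA (eqP Am) add1n prednK // eqxx setU11.
Qed.

End TreeTheory.

(** * Recursion and double counting for subtree costs *)

Section CostTheory.
Variables (R : realFieldType) (V : finType) (T : rooted_tree V) (c : V -> R).

(* A proper descendant [u] of [v] lies below exactly one child of [v], namely
   the ancestor of [u] whose depth is [depth v + 1]. *)
Lemma Cost_children (v : V) :
  Cost T c v = c v + \sum_(w in children T v) Cost T c w.
Proof.
rewrite /Cost (bigD1 v) /=; last by rewrite inE connect0.
congr (_ + _).
pose p u := iter (depth T u - depth T v).-1 (parent T) u.
rewrite (partition_big p (mem (children T v))) => [|u] /=.
  apply: eq_bigr => w wv; apply: eq_bigl => u.
  have dw := depth_child wv.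
  rewrite /p -subnS -dw -fconnect_parentE !inE andb_idl // => uw.
  have wv' : fconnect (parent T) w v.
    by move: wv; rewrite inE => /andP[_ /eqP <-]; apply: fconnect1.
  rewrite (connect_trans uw wv') /=.
  by apply: contraTneq (fconnect_depth uw) => ->; rewrite dw ltnn.
rewrite !inE fconnect_parentE => /andP[/eqP uv u_v].
have k0 : (0 < depth T u - depth T v)%N.
  by rewrite lt0n; apply: contra_neq u_v => k0; rewrite -uv k0.
rewrite /p -iterS prednK // uv eqxx andbT -depth_eq0 depth_iter_parent.
by rewrite subn_eq0 -ltnNge prednK // leq_subr.
Qed.

(** A non-root node has a single parent, so the children of distinct nodes of [x] are disjoint and
    the sum over [hchildren T x] splits by parent. *)
Lemma hCost_hchildren (x : {set V}) :
  hCost T c x = hcost c x + hCost T c (hchildren T x).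
Proof.
rewrite /hCost /hcost (eq_bigr _ (fun v _ => Cost_children v)) big_split /=.
congr (_ + _); rewrite [RHS](partition_big (parent T) (mem x)) => [|w] /=.
  apply: eq_bigr => v vx; apply: eq_bigl => w.
  rewrite mem_hchildren !inE -andbA.
  by case: (eqVneq (parent T w) v) => [->|_]; rewrite ?vx ?andbF.
by rewrite mem_hchildren => /andP[].
Qed.

(** Exchange the sums: each child [w] contributes its cost once for every hyperchild containing it,
    and that number does not depend on [w]. *)
Lemma sum_hCost_hyperchildren (B : nat) (x : {set V}) : (0 < B)%N ->
  \sum_(y in hyperchildren T B x) hCost T c y =
  'C(#|hchildren T x|.-1, (minn B #|hchildren T x|).-1)%:R
    * hCost T c (hchildren T x).
Proof.
move=> B0; rewrite /hCost mulr_sumr.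
rewrite (exchange_big_dep (mem (hchildren T x))) => [|y w] /=; last first.
  by rewrite inE => /andP[/subsetP yS _] /yS.
apply: eq_bigr => w wS; rewrite -(card_hyperchildren_mem B0 wS) sumr_const.
by rewrite mulr_natl; congr (_ *+ _); apply: eq_card => y; rewrite [RHS]inE.
Qed.

End CostTheory.

(** * Laws carried by a single value *)

Section LawTheory.
Variable R : realFieldType.

(** Entries of weight 0 may carry any outcome, since a branch of probability 0 inverts that
    probability. The total weight is imposed because runs cut off by the counter lose theirs. *)
Definition concentrated (d : law R R) (z : R) : Prop :=
  \sum_(p <- d) p.1 = 1 /\ {in d, forall p, p.1 != 0 -> p.2 = z}.

Lemma concentrated_ret (z : R) : concentrated (law_ret R z) z.
Proof. by split=> [|p]; rewrite ?big_seq1 // inE => /eqP->. Qed.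

Lemma concentrated_bind (A : finType) (E : {set A}) (f : A -> R)
    (g : A -> law R R) (z : R) :
  \sum_(a in E) f a = 1 ->
  {in E, forall a, f a != 0 -> concentrated (g a) z} ->
  concentrated (law_bind (law_on E f) g) z.
Proof.
move=> f1 gz; rewrite /law_bind /law_on -map_comp; split.
  rewrite big_flatten big_map big_enum /= -[RHS]f1.
  apply: eq_bigr => a aE; rewrite big_map /= -mulr_sumr.
  have [->|fa0] := eqVneq (f a) 0; first by rewrite mul0r.
  by rewrite (gz a aE fa0).1 mulr1.
move=> p /flatten_mapP[a]; rewrite mem_enum => aE /mapP[q qa ->] /=.
by rewrite mulf_eq0 negb_or => /andP[fa0]; apply: (gz a aE fa0).2.
Qed.

Lemma Pr_concentrated (d : law R R) (z : R) :
  concentrated d z -> Pr d (fun C => C == z) = 1.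
Proof.
move=> [d1 dz]; rewrite /Pr big_mkcond -[RHS]d1 /= !big_seq.
apply: eq_bigr => p pd; case: eqVneq => // pz.
by apply/esym/eqP; apply: contraNT pz => p0; rewrite (dz p pd p0).
Qed.

Lemma Exp_concentrated (d : law R R) (z : R) : concentrated d z -> Exp d = z.
Proof.
move=> [d1 dz]; rewrite /Exp -[RHS]mul1r -d1 mulr_suml !big_seq.
apply: eq_bigr => p pd; have [->|p0] := eqVneq p.1 0; first by rewrite !mul0r.
by rewrite (dz p pd p0).
Qed.

Lemma Var_concentrated (d : law R R) (z : R) : concentrated d z -> Var d = 0.
Proof.
move=> dz; rewrite /Var (Exp_concentrated dz) big_seq big1 // => p pd.
have [->|p0] := eqVneq p.1 0; first by rewrite mul0r.
by rewrite (dz.2 p pd p0) subrr expr0n mulr0.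
Qed.

End LawTheory.

(** * The invariant of the SEP loop *)

Section SEPTheory.
Variables (R : realFieldType) (V : finType) (T : rooted_tree V) (c : V -> R).
Variables (B : nat) (P : {set V} -> {set V} -> R).
Hypothesis B_gt0 : (0 < B)%N.
Hypothesis total_gt0 : forall u : {set V}, hypernode T u ->
  hchildren T u != set0 -> 0 < \sum_(x in hyperchildren T B u) hCost T c x.
Hypothesis PE : forall u : {set V}, hypernode T u -> hchildren T u != set0 ->
  forall w, w \in hyperchildren T B u ->
  P u w = hCost T c w / \sum_(x in hyperchildren T B u) hCost T c x.

Lemma SEP_factorE (x y : {set V}) : hypernode T x -> hchildren T x != set0 ->
  y \in hyperchildren T B x -> P x y != 0 ->
  SEP_factor T P x y * (hCost T c y / #|y|%:R) =
  hCost T c (hchildren T x) / #|x|%:R.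
Proof.
move=> hx S0 yH; rewrite /SEP_factor PE //.
have := total_gt0 hx S0; rewrite sum_hCost_hyperchildren //.
(* Replacing the minimum by [#|y|] turns the binomial of the total into the one in [SEP_factor], so
   that they cancel. *)
move: (yH); rewrite inE => /andP[_ /eqP <-].
set b := _%:R => /lt0r_neq0; rewrite mulf_eq0 negb_or => /andP[b0 h0].
(* A nonzero probability forces [y] to have nonzero cost, hence to be nonempty. *)
rewrite mulf_eq0 negb_or => /andP[y0 _].
have cy0 : #|y|%:R != 0 :> R.
  rewrite pnatr_eq0 cards_eq0; apply: contraNneq y0 => ->.
  by rewrite /hCost big_set0.
have cx0 : #|x|%:R != 0 :> R.
  rewrite pnatr_eq0 cards_eq0; apply: contraNneq S0 => ->.
  by rewrite /hchildren big_set0.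
by field; rewrite b0 h0 y0 cy0 cx0.
Qed.

(** The depth hypothesis guarantees that the counter suffices: depths stay below [#|V|], and each
    step trades one unit of [n] for one level of depth. *)
Lemma SEP_loop_concentrated (n : nat) (x : {set V}) (D C : R) :
  hypernode T x -> {in x, forall u, (#|V| <= n + depth T u)%N} ->
  concentrated (SEP_loop T c B P n x D C)
    (C + D * (hCost T c (hchildren T x) / #|x|%:R)).
Proof.
elim: n x D C => [|n IHn] x D C hx xn /=.
  have [->|/set0Pn[w]] := eqVneq (hchildren T x) set0.
    by rewrite /hCost big_set0 mul0r mulr0 addr0; apply: concentrated_ret.
  by case/bigcupP=> u /xn; rewrite leqNgt depth_lt_card.
have [->|S0] := eqVneq (hchildren T x) set0.
  by rewrite /hCost big_set0 mul0r mulr0 addr0; apply: concentrated_ret.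
apply: concentrated_bind => [|y yH Py0].
  rewrite (eq_bigr _ (PE hx S0)) -mulr_suml divff //.
  exact/lt0r_neq0/total_gt0.
(* Express the claimed value through [y], then split off the cost of [y] itself: that term is what
   the loop adds to [C]. *)
rewrite -(SEP_factorE hx S0 yH Py0) hCost_hchildren.
set D' := D * _.
have -> : C + D * (SEP_factor T P x y *
    ((hcost c y + hCost T c (hchildren T y)) / #|y|%:R)) =
    C + hcost c y / #|y|%:R * D'
    + D' * (hCost T c (hchildren T y) / #|y|%:R).
  by rewrite /D'; ring.
apply: IHn; first exact: hypernode_hchild hx yH.
move: yH; rewrite inE => /andP[/subsetP yS _] w /yS /depth_hchild[u ux ->].
by rewrite addnS -addSn; apply: xn.
Qed.

Lemma SEP_concentrated (v : {set V}) : hypernode T v ->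
  concentrated (SEP T c B P v) (hCost T c v / #|v|%:R).
Proof.
(* The inserted factor 1 is the initial value of [D]. *)
move=> hv; rewrite hCost_hchildren mulrDl -[X in _ + X]mul1r.
by apply: SEP_loop_concentrated => // u _; apply: leq_addr.
Qed.

End SEPTheory.

Theorem theorem2 (R : realFieldType) (V : finType) (T : rooted_tree V)
    (c : V -> R) (B : nat) (P : {set V} -> {set V} -> R)
    (hc : forall v, 0 <= c v)
    (hB : (1 <= B)%N)
    (hpos : forall u : {set V}, hypernode T u -> hchildren T u != set0 ->
       0 < \sum_(x in hyperchildren T B u) hCost T c x)
    (hP : forall u : {set V}, hypernode T u -> hchildren T u != set0 ->
       forall w, w \in hyperchildren T B u ->
       P u w = hCost T c w / \sum_(x in hyperchildren T B u) hCost T c x)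
    (v : {set V}) (hv : hypernode T v) (hv0 : v != set0) :
  Pr (SEP T c B P v) (fun C => C == hCost T c v / #|v|%:R) = 1
  /\ Var (SEP T c B P v) = 0.
Proof.
have hC := SEP_concentrated hB hpos hP hv.
by split; [apply: Pr_concentrated hC | apply: Var_concentrated hC].
Qed.
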